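(* Let $\{u^k=(x^k,y^k,\lambda^k)\}_{k\ge 0}$ be generated by the proximal ADMM (described in the context) under the stated assumptions on the spaces, operators and functions, and assume the minimization problem has a KKT point. Then $$\|\Delta u^k\|_G^2 = o(1/k)\quad\text{as } k\to\infty .$$
   Context: Setting. $\mathcal X,\mathcal Y,\mathcal Z$ are real Hilbert spaces (possibly infinite-dimensional), $c\in\mathcal Z$, $\rho>0$, $A:\mathcal X\to\mathcal Z$ and $B:\mathcal Y\to\mathcal Z$ are bounded linear operators with adjoints $A^*,B^*$, $P:\mathcal X\to\mathcal X$ and $Q:\mathcal Y\to\mathcal Y$ are bounded linear positive semi-definite self-adjoint operators, and $f:\mathcal X\to(-\infty,\infty]$, $g:\mathcal Y\to(-\infty,\infty]$ are proper, lower semi-continuous, convex. For a bounded linear positive semi-definite self-adjoint operator $D$ write $\|u\|_D^2:=\langle u,Du\rangle$. Problem: minimize $H(x,y):=f(x)+g(y)$ subject to $Ax+By=c$. A KKT point is a triple $(\bar x,\bar y,\bar\lambda)\in\mathcal X\times\mathcal Y\times\mathcal Z$ with $-A^*\bar\lambda\in\partial f(\bar x)$, $-B^*\bar\lambda\in\partial g(\bar y)$, $A\bar x+B\bar y=c$. Proximal ADMM: from an arbitrary initial guess $(x^0,y^0,\lambda^0)\in\mathcal X\times\mathcal Y\times\mathcal Z$, for $k\ge0$, $$x^{k+1}\in\arg\min_{x\in\mathcal X}\Big\{f(x)+\langle\lambda^k,Ax\rangle+\tfrac{\rho}{2}\|Ax+By^k-c\|^2+\tfrac12\|x-x^k\|_P^2\Big\},$$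 $$y^{k+1}\in\arg\min_{y\in\mathcal Y}\Big\{g(y)+\langle\lambda^k,By\rangle+\tfrac{\rho}{2}\|Ax^{k+1}+By-c\|^2+\tfrac12\|y-y^k\|_Q^2\Big\},$$ $$\lambda^{k+1}=\lambda^k+\rho(Ax^{k+1}+By^{k+1}-c),$$ where it is assumed that minimizers of the subproblems exist, so that the sequence is well defined. Notation: $\widehat Q:=\rho B^*B+Q$, $G(x,y,\lambda):=(Px,\widehat Qy,\lambda/\rho)$, so $\|u\|_G^2=\|x\|_P^2+\|y\|_{\widehat Q}^2+\frac1\rho\|\lambda\|^2$ for $u=(x,y,\lambda)$. For $k\ge1$: $\Delta u^k:=u^k-u^{k-1}$. *)

(* Defs.v *)
From HB Require Import structures.
From mathcomp Require Import all_boot all_order all_algebra.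
From mathcomp Require Import sesquilinear ring lra.
From mathcomp Require Import all_classical all_reals all_analysis.

Set Implicit Arguments.
Unset Strict Implicit.
Unset Printing Implicit Defensive.

Import Order.TTheory GRing.Theory Num.Theory.
Import numFieldNormedType.Exports.

Local Open Scope classical_set_scope.
Local Open Scope ring_scope.

(* A real Hilbert space is a complete normed module whose norm is induced by a
   positive definite symmetric bilinear form. *)
HB.mixin Record isHilbert (R : realType) H of CompleteNormedModule R H := {
  inner : {dot H for (@idfun R)} ;
  innerxx : forall x : H, inner x x = `|x| ^+ 2
}.

#[short(type="hilbertType")]
HB.structure Definition Hilbert (R : realType) :=
  {H of CompleteNormedModule R H & isHilbert R H}.

Notation "''[' u , v ]" := (inner u v) : ring_scope.

Section riesz.
Context (R : realType) (H : hilbertType R).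
Implicit Types x y v : H.

Lemma innerC x y : '[x, y] = '[y, x].
Proof. by have := hermitian_subproof (s := inner) x y; rewrite expr0 mul1r. Qed.

Lemma innerDl x y v : '[x + y, v] = '[x, v] + '[y, v].
Proof. exact: linearDl. Qed.

Lemma innerDr x y v : '[v, x + y] = '[v, x] + '[v, y].
Proof. exact: linearDr. Qed.

Lemma innerZr a x y : '[x, a *: y] = a * '[x, y].
Proof. exact: linearZr_LR. Qed.

Lemma innerNr x y : '[x, - y] = - '[x, y].
Proof. exact: linearNr. Qed.

Lemma sqnormD x y : `|x + y| ^+ 2 = `|x| ^+ 2 + `|y| ^+ 2 + 2 * '[x, y].
Proof. rewrite -!innerxx innerDl !innerDr (innerC y x); ring. Qed.

Lemma inner_le_norm x y : '[x, y] <= `|x| * `|y|.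
Proof.
have h : `|x + y| ^+ 2 <= (`|x| + `|y|) ^+ 2.
  by rewrite ler_sqr ?nnegrE ?addr_ge0// ler_normD.
move: h; rewrite sqnormD; nra.
Qed.

Lemma cauchy_schwarz x y : `|'[x, y]| <= `|x| * `|y|.
Proof.
rewrite ler_norml inner_le_norm andbT lerNl -innerNr.
by rewrite -[X in _ <= _ * X]normrN inner_le_norm.
Qed.

(* Minimize [x |-> `|x| ^+ 2 / 2 - phi x]. *)
Lemma riesz (phi : H -> R) (M : R) :
  (forall a x y, phi (a *: x + y) = a * phi x + phi y) ->
  (forall x, `|phi x| <= M * `|x|) ->
  exists w, forall x, phi x = '[x, w].
Proof.
move=> lphi bphi.
have phiD x y : phi (x + y) = phi x + phi y.
  by rewrite -[x in LHS]scale1r lphi mul1r.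
have phi0 : phi 0 = 0 by have := phiD 0 0; rewrite addr0; lra.
have phiZ a x : phi (a *: x) = a * phi x.
  by rewrite -[_ *: _]addr0 lphi phi0 addr0.
pose J x : R := `|x| ^+ 2 / 2 - phi x.
have infJ : has_inf (range J).
  split; first by exists (J 0), 0.
  exists (- (M ^+ 2) / 2) => _ [x _ <-]; rewrite /J.
  have := bphi x; rewrite ler_norml => /andP[_ h].
  have := sqr_ge0 (`|x| - M); nra.
set d := inf (range J).
have dJ x : d <= J x by apply: ge_inf; [exact: infJ.2|exists x].
have mini n : exists x, J x < d + n.+1%:R^-1.
  have [|_ [x _ <-] h] := inf_adherent (_ : 0 < n.+1%:R^-1 :> R) infJ.
    by rewrite invr_gt0 ltr0n.
  by exists x.
have [u Ju] := choice mini.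
have quarter x y : `|x - y| ^+ 2 <= 4 * (J x + J y - 2 * d).
  have h := dJ (2^-1 *: (x + y)).
  move: h; rewrite /J phiZ phiD normrZ exprMn.
  rewrite (ger0_norm (_ : 0 <= 2^-1)) ?invr_ge0//.
  rewrite !sqnormD normrN innerNr; lra.
have cu : cvg (u @ \oo).
  apply/cauchy_cvgP/cauchy_exP => e e0.
  have e8 : 0 < e ^+ 2 / 8 by rewrite divr_gt0 // exprn_gt0.
  have [N _ hN] := near_infty_natSinv_lt (PosNum e8).
  exists (u N); exists N => // n /= Nn.
  rewrite -ball_normE /=.
  rewrite -(ltr_pXn2r (n := 2)) ?nnegrE ?normr_ge0 ?(ltW e0)//.
  apply: le_lt_trans (quarter _ _) _.
  have /= := hN n Nn; have /= := hN N (leqnn N).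
  have := Ju n; have := Ju N.
  move: (N.+1%:R^-1) (n.+1%:R^-1) => ? ?; lra.
pose p := lim (u @ \oo).
have up : u @ \oo --> p by [].
exists p => v.
have [->|v0] := eqVneq v 0; first by rewrite phi0 linear0l.
apply/eqP; rewrite -subr_eq0 -normr_eq0; apply/eqP/le_anti/andP; split => //.
suff he (e : R) : 0 < e -> `|phi v - '[v, p]| <= e.
  by apply/ler_addgt0Pr => e e0; rewrite add0r; exact: he.
move=> e0.
have nv0 : 0 < `|v| by rewrite normr_gt0.
have nv20 : 0 < `|v| ^+ 2 by rewrite exprn_gt0.
have e2v : 0 < e / 2 / `|v| by rewrite !divr_gt0.
have e3v : 0 < (e / 2) ^+ 2 / (2 * `|v| ^+ 2).
  by rewrite divr_gt0 ?exprn_gt0 ?divr_gt0 ?mulr_gt0.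
have [n hn1 hn2] : exists2 n, `|p - u n| < e / 2 / `|v| &
    n.+1%:R^-1 < (e / 2) ^+ 2 / (2 * `|v| ^+ 2).
  near \oo => n; exists n; near: n.
    by move/cvgrPdist_lt : up => /(_ _ e2v).
  exact: (near_infty_natSinv_lt (PosNum e3v)).
have h1 : `|phi v - '[v, u n]| <= e / 2.
  set a := phi v - _.
  have h := dJ (u n + (a / `|v| ^+ 2) *: v).
  have := Ju n; move: h; rewrite /J sqnormD phiD phiZ.
  rewrite innerZr innerC normrZ normf_div (ger0_norm (ltW nv20)) => h h'.
  rewrite -(ler_pXn2r (n := 2)) ?nnegrE// ?divr_ge0 ?(ltW e0)//.
  rewrite real_normK ?num_real//.
  have q1 : (`|a| / `|v| ^+ 2 * `|v|) ^+ 2 = a ^+ 2 / `|v| ^+ 2.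
    rewrite -[in RHS](real_normK (num_real a)); field; exact: lt0r_neq0.
  have q2 : a / `|v| ^+ 2 * '[v, u n] = a / `|v| ^+ 2 * (phi v - a).
    by rewrite /a subKr.
  move: h; rewrite q1 q2 => h.
  have q3 : a ^+ 2 / `|v| ^+ 2 <= 2 * ((e / 2) ^+ 2 / (2 * `|v| ^+ 2)).
    have : a / `|v| ^+ 2 * (phi v - a) = a / `|v| ^+ 2 * phi v - a ^+ 2 / `|v| ^+ 2.
      by rewrite mulrBr; congr (_ - _); rewrite mulrAC -expr2.
    move=> q4; move: hn2 h' h; rewrite q4.
    move: (_ / (2 * _)) n.+1%:R^-1 (a ^+ 2 / _) (a / _ * _) => b c r s; lra.
  have q5 : 2 * ((e / 2) ^+ 2 / (2 * `|v| ^+ 2)) = (e / 2) ^+ 2 / `|v| ^+ 2.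
    by field; exact: lt0r_neq0.
  by move: q3; rewrite q5 ler_pM2r ?invr_gt0.
have h2 : `|'[v, u n] - '[v, p]| <= e / 2.
  rewrite -innerNr -innerDr; apply: le_trans (cauchy_schwarz _ _) _.
  by rewrite mulrC -ler_pdivlMr// distrC ltW.
have -> : phi v - '[v, p] = (phi v - '[v, u n]) + ('[v, u n] - '[v, p]).
  by rewrite addrA subrK.
apply: le_trans (ler_normD _ _) _; lra.
Unshelve. all: by end_near. Qed.

End riesz.

Section operators.
Context (R : realType) (U V : hilbertType R).

(* For a linear map this is [exists M, forall x, `|L x| <= M * `|x|]; see
   [linear_boundedP]. *)
Definition bounded_operator (L : U -> V) : Prop := bounded_near L (nbhs 0).

(* The value at [z] is the Riesz representative of [x |-> '[L x, z]]. *)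
Definition adjoint (L : U -> V) (z : V) : U :=
  xget 0 [set w | forall x, '[L x, z] = '[x, w]].

Lemma adjointP (L : {linear U -> V}) : bounded_operator L ->
  forall x z, '[L x, z] = '[x, adjoint L z].
Proof.
move=> bL x z; rewrite /adjoint; case: xgetP => [w _ /(_ x) //|noadj].
have [M hM] : exists M, forall x, `|L x| <= M * `|x|.
  have /linear_boundedP hL := bL.
  by near +oo_R => r; exists r; near: r.
have [w hw] : exists w, forall x, '[L x, z] = '[x, w].
  apply: (@riesz _ _ (fun x => '[L x, z]) (M * `|z|)) => [a x1 x2|x1].
    by rewrite linearP innerDl innerC innerZr innerC.
  apply: le_trans (cauchy_schwarz _ _) _.
  by rewrite mulrAC ler_wpM2r.
by have := noadj w hw.
Unshelve. all: by end_near. Qed.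

End operators.

Section functionals.
Context (R : realType) (H : hilbertType R).
Implicit Types (D : H -> H) (f : H -> \bar R).

Definition self_adjoint D : Prop := forall u v, '[D u, v] = '[u, D v].

Definition positive_semidefinite D : Prop := forall u, 0 <= '[u, D u].

Definition sqnorm D (u : H) : R := '[u, D u].

Definition proper_fun f : Prop :=
  (forall x, f x != -oo%E) /\ (exists x, f x != +oo%E).

(* Only used for proper [f], so that [-oo + +oo] never occurs on the right. *)
Definition convex_fun f : Prop :=
  forall (t : R) (x y : H), 0 < t < 1 ->
  (f (t *: x + (1 - t) *: y)%R <= t%:E * f x + (1 - t)%:E * f y)%E.

Definition subdifferential f (x : H) : set H :=
  [set v | forall x', (f x + '[v, x' - x]%:E <= f x')%E].

Definition argmin f : set H := [set x | forall x', (f x <= f x')%E].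

End functionals.

Section admm.
Context (R : realType) (X Y Z : hilbertType R).
Variables (A : X -> Z) (B : Y -> Z) (c : Z) (rho : R).
Variables (P : X -> X) (Q : Y -> Y) (f : X -> \bar R) (g : Y -> \bar R).

Definition kkt_point (u : X * Y * Z) : Prop :=
  let: (x, y, lam) := u in
  [/\ subdifferential f x (- adjoint A lam),
      subdifferential g y (- adjoint B lam)
    & A x + B y = c].

Definition x_objective (x0 : X) (y0 : Y) (lam0 : Z) (x : X) : \bar R :=
  (f x + ('[lam0, A x] + rho / 2 * `|A x + B y0 - c| ^+ 2
          + 2^-1 * sqnorm P (x - x0))%:E)%E.

Definition y_objective (x1 : X) (y0 : Y) (lam0 : Z) (y : Y) : \bar R :=
  (g y + ('[lam0, B y] + rho / 2 * `|A x1 + B y - c| ^+ 2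
          + 2^-1 * sqnorm Q (y - y0))%:E)%E.

Definition proximal_admm (x : nat -> X) (y : nat -> Y) (lam : nat -> Z) : Prop :=
  forall k,
  [/\ argmin (x_objective (x k) (y k) (lam k)) (x k.+1),
      argmin (y_objective (x k.+1) (y k) (lam k)) (y k.+1)
    & lam k.+1 = lam k + rho *: (A (x k.+1) + B (y k.+1) - c)].

Definition Qhat (y : Y) : Y := rho *: adjoint B (B y) + Q y.

Definition Gop (u : X * Y * Z) : X * Y * Z :=
  let: (x, y, lam) := u in (P x, Qhat y, rho^-1 *: lam).

(* The canonical norm of the type [X * Y * Z] is the maximum norm, so it is not
   a [hilbertType]; this is the Hilbert inner product of the product space. *)
Definition inner_prod (u v : X * Y * Z) : R :=
  '[u.1.1, v.1.1] + '[u.1.2, v.1.2] + '[u.2, v.2].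

Definition sqnormG (u : X * Y * Z) : R := inner_prod u (Gop u).

(* Meaningful for [1 <= k]; the value at [k = 0] is [0]. *)
Definition delta (u : nat -> X * Y * Z) (k : nat) : X * Y * Z := u k - u k.-1.

End admm.

(* Main.v *)
Require Import Defs.
From HB Require Import structures.
From mathcomp Require Import all_boot all_order all_algebra.
From mathcomp Require Import ring lra.
From mathcomp Require Import all_classical all_reals all_analysis.
Import Order.TTheory GRing.Theory Num.Theory.
Import numFieldNormedType.Exports.
Local Open Scope classical_set_scope.
Local Open Scope ring_scope.

(** The increments [delta u k] are handled through perturbed KKT systems.  The
    optimality conditions of the two subproblems, rewritten with the updated
    multiplier, say that the iterate [u = u (k.+1)] solves the KKT system up to
    terms depending on the increment [d = delta u k.+1]:

      - (A^* (lambda - rho B d_y) + P d_x) \in df x,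
      - (B^* lambda + Q d_y) \in dg y,
      rho (A x + B y - c) = d_lambda.

    A KKT point solves the same system with [d = 0].  If [u, u'] solve it with
    perturbations [d, d'], adding the monotonicity inequalities of the two
    subdifferentials gives, for [w = u - u'] and [h = d - d'],

      <w, G h> <= <B h_y, h_lambda>,

    and polarization of [G] turns this into an upper bound for |w|_G^2
    ([sqnormG_decrease]):

      |w|_G^2 + |h|_G^2 - 2 <B h_y, h_lambda> <= |w - h|_G^2.

    This inequality is used twice.

    Comparing two consecutive iterates, [w] is [delta u k.+1] and [w - h] is
    [delta u k].  Since 2 <B h_y, h_lambda> <= |h|_G^2 by Young's inequality,
    the increments are nonincreasing in the G-seminorm ([sqnormG_delta_le]).

    Comparing an iterate with a KKT point [ubar], [w] is [u k.+1 - ubar] and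
    [w - h] is [u k - ubar].  Here the cross term 2 <B h_y, h_lambda> is not
    absorbed by |h|_G^2, which has to survive; instead, monotonicity of dg
    between consecutive iterates bounds it by the decrease of |d_y|_Q^2
    ([cross_term_le]).  Hence |u k - ubar|_G^2 + |(delta u k)_y|_Q^2 decreases
    by at least |delta u k.+1|_G^2 at each step ([lyapunov_decrease]).

    So the increments form a nonincreasing sequence with a bounded telescoping
    sum, and such a sequence is o(1/k) ([telescoping_littleo]). *)

(** * Inner products and adjoints *)

Section inner_products.
Context {R : realType} {H : hilbertType R}.
Implicit Types (u v w : H) (a : R).

Lemma innerNl u v : '[- u, v] = - '[u, v].
Proof. by rewrite innerC innerNr innerC. Qed.

Lemma innerZl a u v : '[a *: u, v] = a * '[u, v].
Proof. by rewrite innerC innerZr innerC. Qed.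

Lemma innerBl u v w : '[u - v, w] = '[u, w] - '[v, w].
Proof. by rewrite innerDl innerNl. Qed.

Lemma innerBr u v w : '[w, u - v] = '[w, u] - '[w, v].
Proof. by rewrite innerDr innerNr. Qed.

Lemma self_adjointC {D : H -> H} :
  self_adjoint D -> forall u v, '[u, D v] = '[v, D u].
Proof. by move=> D_sa u v; rewrite -D_sa innerC. Qed.

End inner_products.

Definition innerE := (@innerBl, @innerBr, @innerDl, @innerDr, @innerNl,
  @innerNr, @innerZl, @innerZr).

Section proximal_terms.
Context {R : realType}.

Lemma inner_adjointl {H Z : hilbertType R} {L : {linear H -> Z}} :
  bounded_operator L -> forall z v, '[adjoint L z, v] = '[z, L v].
Proof. by move=> bL z v; rewrite innerC -adjointP// innerC. Qed.

(** Second-order Taylor expansion, exact because both subproblems of the ADMM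
    have a quadratic smooth part of this one form; the coefficient of [t] shows
    the gradient, in which the multiplier appears already updated to
    [l + rho *: (L h + b)]. *)
Lemma proximal_gradient_expansion {H Z : hilbertType R} (L : {linear H -> Z})
    (D : {linear H -> H}) (rho : R) (l b : Z) (h0 h d : H) (t : R) :
  bounded_operator L -> self_adjoint D ->
  let q h := '[l, L h] + rho / 2 * `|L h + b| ^+ 2 + 2^-1 * sqnorm D (h - h0) in
  q (h + t *: d) =
    q h + t * '[adjoint L (l + rho *: (L h + b)) + D (h - h0), d]
    + t ^+ 2 * (rho / 2 * `|L d| ^+ 2 + 2^-1 * sqnorm D d).
Proof.
move=> bL D_sa q; rewrite /q /sqnorm innerDl inner_adjointl //.
rewrite -!innerxx !(linearB D) !(linearD D) !(linearD L).
rewrite !(linearZZ L) !(linearZZ D) !innerE /=.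
rewrite (D_sa h d) (D_sa h0 d) (self_adjointC D_sa h0 h)
  (self_adjointC D_sa d h) (self_adjointC D_sa d h0).
rewrite (innerC (L d) (L h)) (innerC b (L d)) (innerC b (L h)).
by field.
Qed.

End proximal_terms.

(** * Subdifferentials of convex functions *)

Section subdifferentials.
Context {R : realType} {H : hilbertType R} {f : H -> \bar R}.
Hypothesis f_proper : proper_fun f.

Lemma subdifferential_fin_num {x v} :
  subdifferential f x v -> f x \is a fin_num.
Proof.
case: f_proper => fNy [x0 fx0] /(_ x0).
move: (fNy x) (fNy x0) fx0.
by case: (f x) => [r| |]; case: (f x0) => [s| |].
Qed.

(** Evaluate each subgradient inequality at the base point of the other and
    add: the function values, which are finite, cancel. *)
Lemma subdifferential_monotone {x1 x2 v1 v2} :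
  subdifferential f x1 v1 -> subdifferential f x2 v2 ->
  0 <= '[v1 - v2, x1 - x2].
Proof.
move=> s1 s2; have f1 := subdifferential_fin_num s1.
have f2 := subdifferential_fin_num s2.
move: (s1 x2) (s2 x1); rewrite -(fineK f1) -(fineK f2) -!EFinD !lee_fin !innerE.
lra.
Qed.

(** Fermat's rule for a convex function plus a smooth one whose gradient at [x]
    is [v].  Minimality is tested on the segment from [x] to [x']: convexity
    bounds [f] there by its chord, so dividing by the step [t] and letting [t]
    tend to 0 leaves only the first-order term of [q]. *)
Lemma argmin_subdifferential {q s : H -> R} {x v : H} :
  convex_fun f ->
  (forall t d, q (x + t *: d) = q x + t * '[v, d] + t ^+ 2 * s d) ->
  argmin (fun x' => f x' + (q x')%:E)%E x -> subdifferential f x (- v).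
Proof.
move=> f_convex qE xmin x'.
case: f_proper => fNy [x0 fx0].
have fx : f x \is a fin_num.
  have := xmin x0; move: (fNy x) (fNy x0) fx0.
  by case: (f x) => [r| |]; case: (f x0) => [r'| |].
have [->|fx'y] := eqVneq (f x') +oo%E; first by rewrite leey.
have fx' : f x' \is a fin_num by rewrite fin_numE fNy.
rewrite -(fineK fx) -(fineK fx') -EFinD lee_fin innerNl.
set r := fine (f x); set r' := fine (f x'); set l := '[v, _].
pose S := `|s (x' - x)|.
have small t : 0 < t < 1 -> 0 <= r' - r + l + t * S.
  move=> t01; have /andP[t0 t1] := t01.
  have zE : t *: x' + (1 - t) *: x = x + t *: (x' - x).
    by rewrite scalerBl scale1r scalerBr addrCA.
  have := f_convex t x' x t01; have := xmin (x + t *: (x' - x)).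
  rewrite zE qE -(fineK fx) -(fineK fx') -!EFinM -!EFinD.
  move: (fNy (x + t *: (x' - x))).
  case: (f (x + t *: (x' - x))) => [z| |] // _.
  rewrite -!EFinD !lee_fin -/r -/r' -/l => h1 h2.
  have sS : s (x' - x) <= S by rewrite ler_norm.
  have h3 : t ^+ 2 * s (x' - x) <= t * (t * S).
    by rewrite mulrA -expr2 ler_wpM2l ?sqr_ge0.
  rewrite -(pmulr_rge0 _ t0); lra.
have S0 : 0 <= S by rewrite normr_ge0.
rewrite lerBlDr -subr_ge0.
apply/ler_addgt0Pr => e e0.
(* a step in ]0, 1[ so small that t * S <= e *)
have t01 : 0 < e / (e + S + 1) < 1.
  have p : 0 < e + S + 1 by lra.
  by rewrite divr_gt0//= ltr_pdivrMr//; lra.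
have := small _ t01.
have : e / (e + S + 1) * S <= e.
  have p : 0 < e + S + 1 by lra.
  rewrite mulrAC ler_pdivrMr//; nra.
lra.
Qed.

End subdifferentials.

(** * Nonincreasing sequences with a telescoping majorant *)

Section sequences.
Context {R : realType}.

(** As [a] is nonincreasing, [m * a (N.+1 + m)] is at most the sum of the [m]
    terms of [a] after index [N.+1], hence at most [V N.+1 - inf V], which is
    small for [N] large; and [m] is at least half of [N.+1 + m] as soon as
    [m >= N.+1].  The hypotheses start at [k = 1] because the increment of
    index 0 is a dummy value. *)
Lemma telescoping_littleo {a V : nat -> R} :
  (forall k, 0 <= a k) -> (forall k, 0 <= V k) ->
  (forall k, (0 < k)%N -> a k.+1 <= a k) ->
  (forall k, (0 < k)%N -> a k.+1 + V k.+1 <= V k) ->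
  a =o_\oo (fun k : nat => k%:R^-1 : R).
Proof.
move=> a0 V0 a_le V_le; apply/eqoP => e e0.
pose W := [set V k.+1 | k in [set: nat]].
have infW : has_inf W.
  split; first by exists (V 1%N), 0%N.
  by exists 0 => _ [k _ <-].
have e2 : 0 < e / 2 by rewrite divr_gt0.
have [_ [N _ <-] VN] := inf_adherent e2 infW.
have sum_a m : m%:R * a (N.+1 + m)%N <= V N.+1 - V (N.+1 + m)%N.
  elim: m => [|m IH]; first by rewrite mul0r addn0 subrr.
  have := a_le (N.+1 + m)%N isT; have := V_le (N.+1 + m)%N isT.
  rewrite addnS -natr1 mulrDl mul1r => h1 h2.
  have : m%:R * a (N.+1 + m).+1 <= m%:R * a (N.+1 + m)%N by rewrite ler_wpM2l.
  lra.
exists (2 * N.+1)%N => // k /= kN.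
have k0 : 0 < k%:R :> R by rewrite ltr0n; apply: leq_trans kN.
rewrite !ger0_norm ?invr_ge0 ?(ltW k0)// ler_pdivlMr// mulrC.
have Nk : (N.+1 <= k)%N by apply: leq_trans kN; rewrite mul2n -addnn leq_addr.
have := sum_a (k - N.+1)%N; rewrite subnKC// natrB//.
have : inf W <= V k.
  apply: ge_inf; first exact: infW.2.
  by exists k.-1 => //; rewrite prednK //; exact: leq_trans Nk.
have hk : 2 * N.+1%:R <= k%:R :> R by rewrite -natrM ler_nat.
have := a0 k; move: VN hk; move: (k%:R) (N.+1%:R) (a k) => K M b ? ? ? ? ?.
nra.
Qed.

End sequences.

(** * Proximal ADMM *)

Section proximal_admm.
Context {R : realType} {X Y Z : hilbertType R}.
Context {A : {linear X -> Z}} {B : {linear Y -> Z}} {c : Z} {rho : R}.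
Context {P : {linear X -> X}} {Q : {linear Y -> Y}}.
Context {f : X -> \bar R} {g : Y -> \bar R}.
Context {x : nat -> X} {y : nat -> Y} {lam : nat -> Z}.
Hypothesis admm : proximal_admm A B c rho P Q f g x y lam.
Hypothesis rho_gt0 : 0 < rho.
Hypotheses (A_bounded : bounded_operator A) (B_bounded : bounded_operator B).
Hypotheses (P_sa : self_adjoint P) (P_psd : positive_semidefinite P).
Hypotheses (Q_sa : self_adjoint Q) (Q_psd : positive_semidefinite Q).
Hypotheses (f_proper : proper_fun f) (f_convex : convex_fun f).
Hypotheses (g_proper : proper_fun g) (g_convex : convex_fun g).

Local Notation G := (Gop B rho P Q).
Local Notation normG := (sqnormG B rho P Q).
Implicit Types u d : X * Y * Z.

(** The KKT system at [u], perturbed by the increment [d] that led to [u]. *)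
Definition optimal_step u d : Prop :=
  [/\ subdifferential f u.1.1
        (- (adjoint A (u.2 - rho *: B d.1.2) + P d.1.1)),
      subdifferential g u.1.2 (- (adjoint B u.2 + Q d.1.2))
    & rho *: (A u.1.1 + B u.1.2 - c) = d.2].

Lemma inner_GopE u d : inner_prod u (G d) =
  '[u.1.1, P d.1.1] + (rho * '[B u.1.2, B d.1.2] + '[u.1.2, Q d.1.2])
  + rho^-1 * '[u.2, d.2].
Proof.
by case: d => [[dx dy] dl]; rewrite /inner_prod /= !innerE -adjointP.
Qed.

Lemma cross_le_sqnormG u : 2 * '[B u.1.2, u.2] <= normG u.
Proof.
rewrite /sqnormG inner_GopE.
have := P_psd u.1.1; have := Q_psd u.1.2.
(* Young's inequality, as the expansion of a square *)
have : 0 <= rho^-1 * '[rho *: B u.1.2 - u.2, rho *: B u.1.2 - u.2].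
  by rewrite mulr_ge0 ?invr_ge0 ?(ltW rho_gt0)// innerxx sqr_ge0.
rewrite !innerE (innerC u.2) => h.
have {h} : 0 <= rho * '[B u.1.2, B u.1.2] - 2 * '[B u.1.2, u.2]
    + rho^-1 * '[u.2, u.2].
  move: h; congr (_ <= _); field; exact: lt0r_neq0.
lra.
Qed.

Lemma sqnormG_ge0 u : 0 <= normG u.
Proof.
rewrite /sqnormG inner_GopE !innerxx.
have rhoV : 0 <= rho^-1 by rewrite invr_ge0 ltW.
by rewrite !(addr_ge0, mulr_ge0) ?sqr_ge0 ?P_psd ?Q_psd// ltW.
Qed.

Lemma sqnormGB u d : normG (u - d) = normG u + normG d - 2 * inner_prod u (G d).
Proof.
rewrite /sqnormG !inner_GopE /= (linearB P) (linearB B) (linearB Q) !innerE.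
rewrite (innerC d.2) (innerC (B d.1.2)).
rewrite (self_adjointC P_sa d.1.1 u.1.1) (self_adjointC Q_sa d.1.2 u.1.2).
ring.
Qed.

Lemma sqnormQB (v w : Y) :
  sqnorm Q (v - w) = sqnorm Q v + sqnorm Q w - 2 * '[v, Q w].
Proof.
rewrite /sqnorm (linearB Q) !innerE (self_adjointC Q_sa w v); ring.
Qed.

(** Sum of the monotonicity inequalities of the two subdifferentials.  The
    primal difference [A w_x] is eliminated with the multiplier equation
    [rho (A w_x + B w_y) = h_lambda], which is what makes the coupling terms
    assemble into the G-form, up to the single cross term on the right. *)
Lemma optimal_step_inner {u u' d d'} :
  optimal_step u d -> optimal_step u' d' ->
  inner_prod (u - u') (G (d - d')) <= '[B (d - d').1.2, (d - d').2].
Proof.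
move=> [fu gu cu] [fu' gu' cu'].
have AE w : '[w, A (u.1.1 - u'.1.1)] =
    rho^-1 * '[w, d.2 - d'.2] - '[w, B (u.1.2 - u'.1.2)].
  rewrite -cu -cu' (linearB A) (linearB B) !innerE; field; exact: lt0r_neq0.
have := subdifferential_monotone f_proper fu fu'.
have := subdifferential_monotone g_proper gu gu'.
rewrite !innerBl !innerNl !innerDl !inner_adjointl // inner_GopE /= => gm fm.
have {gm} : 0 <= - '[u.2 - u'.2, B (u.1.2 - u'.1.2)]
    - '[u.1.2 - u'.1.2, Q (d.1.2 - d'.1.2)].
  rewrite innerBl (linearB Q) innerBr !(innerC _ (Q _)); lra.
have {fm} : 0 <= - '[u.2 - u'.2, A (u.1.1 - u'.1.1)]
    + rho * '[B (d.1.2 - d'.1.2), A (u.1.1 - u'.1.1)]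
    - '[u.1.1 - u'.1.1, P (d.1.1 - d'.1.1)].
  rewrite (linearB P) (linearB B d.1.2) (innerBr (P _)) !(innerC _ (P _)).
  move: fm; rewrite !innerBl !innerZl; lra.
rewrite !AE mulrBr mulrA mulfV ?lt0r_neq0// mul1r.
rewrite (innerC (B (d.1.2 - _)) (B (u.1.2 - _))); lra.
Qed.

Lemma sqnormG_decrease {u u' d d'} :
  optimal_step u d -> optimal_step u' d' ->
  normG (u - u') + normG (d - d') - 2 * '[B (d - d').1.2, (d - d').2]
  <= normG (u - u' - (d - d')).
Proof.
move=> ud ud'; rewrite (sqnormGB (u - u')).
have := optimal_step_inner ud ud'; lra.
Qed.

Lemma kkt_optimal_step {u} : kkt_point A B c f g u -> optimal_step u 0.
Proof.
case: u => [[x' y'] l] [fx gy AB]; split=> /=.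
- by rewrite !linear0 !addr0.
- by rewrite linear0 addr0.
- by rewrite AB subrr scaler0.
Qed.

Local Notation u := (fun n => (x n, y n, lam n)).

(** The [x]-subproblem is solved with the old [y k]; expressing its optimality
    condition with the new multiplier costs the correction [rho B d_y]. *)
Lemma admm_optimal_step k : optimal_step (u k.+1) (delta u k.+1).
Proof.
have [xmin ymin lamE] := admm k; split=> /=.
- have -> : lam k.+1 - rho *: B (y k.+1 - y k) =
      lam k + rho *: (A (x k.+1) + (B (y k) - c)).
    rewrite lamE -addrA -scalerBr -!addrA; congr (_ + _ *: (_ + _)).
    by rewrite (linearB B) opprB addrCA [B _ + (_ - _)]addrC subrK addrC.
  apply: (argmin_subdifferential f_proper f_convex) => [t d|].
    exact: (proximal_gradient_expansion A P rho (lam k) (B (y k) - c) (x k)).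
  by move=> x'; have := xmin x'; rewrite /x_objective -!addrA.
- have -> : lam k.+1 = lam k + rho *: (B (y k.+1) + (A (x k.+1) - c)).
    by rewrite lamE addrCA addrA.
  apply: (argmin_subdifferential g_proper g_convex) => [t d|].
    exact: (proximal_gradient_expansion
      B Q rho (lam k) (A (x k.+1) - c) (y k)).
  move=> y'; have := ymin y'; rewrite /y_objective.
  by rewrite ![A _ + _ - _]addrAC ![A _ - _ + _]addrC.
- by rewrite lamE [RHS]addrAC subrr add0r.
Qed.

(** Comparison of two consecutive steps.  The step leading to [u 1] is the first
    one that satisfies optimality conditions, whence [0 < k]. *)
Lemma sqnormG_delta_le k : (0 < k)%N ->
  normG (delta u k.+1) <= normG (delta u k).
Proof.
case: k => // k _.
have := sqnormG_decrease (admm_optimal_step k.+1) (admm_optimal_step k).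
rewrite -[u k.+2 - u k.+1]/(delta u k.+2) subKr.
have := cross_le_sqnormG (delta u k.+2 - delta u k.+1); lra.
Qed.

(** Monotonicity of dg between consecutive iterates gives
    <B d_y, d_lambda> <= <Q (d'_y - d_y), d_y> with [d'] the previous increment,
    and the right-hand side telescopes by polarization of [Q]. *)
Lemma cross_term_le k : (0 < k)%N ->
  2 * '[B (delta u k.+1).1.2, (delta u k.+1).2]
    <= sqnorm Q (delta u k).1.2 - sqnorm Q (delta u k.+1).1.2.
Proof.
case: k => // k _.
have [_ g1 _] := admm_optimal_step k; have [_ g2 _] := admm_optimal_step k.+1.
have := subdifferential_monotone g_proper g2 g1.
rewrite !innerBl !innerNl !innerDl !inner_adjointl // /delta /=.
set d1 := y k.+1 - y k; set d2 := y k.+2 - y k.+1; set b := B d2 => h.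
have h1 : '[b, lam k.+2 - lam k.+1] <= '[Q d1, d2] - '[Q d2, d2].
  rewrite innerBr !(innerC b); lra.
have := Q_psd (d2 - d1); rewrite -/(sqnorm Q _) sqnormQB.
move: h1; rewrite (innerC (Q d1)) (innerC (Q d2)) -/(sqnorm Q d2); lra.
Qed.

(** Comparison of an iterate with a KKT point, which is a perturbed KKT system
    with increment 0. *)
Lemma lyapunov_decrease ubar k : kkt_point A B c f g ubar -> (0 < k)%N ->
  normG (delta u k.+1)
    + (normG (u k.+1 - ubar) + sqnorm Q (delta u k.+1).1.2)
  <= normG (u k - ubar) + sqnorm Q (delta u k).1.2.
Proof.
move=> ubarP k0.
have := sqnormG_decrease (admm_optimal_step k) (kkt_optimal_step ubarP).
rewrite subr0 (_ : u k.+1 - ubar - delta u k.+1 = u k - ubar).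
  have := cross_term_le k k0; lra.
by rewrite addrAC /delta subKr.
Qed.

End proximal_admm.

Theorem proposition2p5 (R : realType) (X Y Z : hilbertType R)
    (A : {linear X -> Z}) (B : {linear Y -> Z}) (c : Z) (rho : R)
    (P : {linear X -> X}) (Q : {linear Y -> Y})
    (f : X -> \bar R) (g : Y -> \bar R)
    (rho_gt0 : 0 < rho)
    (A_bounded : bounded_operator A) (B_bounded : bounded_operator B)
    (P_bounded : bounded_operator P) (P_sa : self_adjoint P)
    (P_psd : positive_semidefinite P)
    (Q_bounded : bounded_operator Q) (Q_sa : self_adjoint Q)
    (Q_psd : positive_semidefinite Q)
    (f_proper : proper_fun f) (f_lsc : lower_semicontinuous f)
    (f_convex : convex_fun f)
    (g_proper : proper_fun g) (g_lsc : lower_semicontinuous g)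
    (g_convex : convex_fun g)
    (x : nat -> X) (y : nat -> Y) (lam : nat -> Z)
    (admm : proximal_admm A B c rho P Q f g x y lam)
    (kkt : exists u, kkt_point A B c f g u) :
  (fun k : nat => sqnormG B rho P Q (delta (fun n => (x n, y n, lam n)) k))
    =o_\oo (fun k : nat => k%:R^-1 : R).
Proof.
have [ubar ubarP] := kkt.
pose u n := (x n, y n, lam n).
apply: (telescoping_littleo
  (V := fun k => sqnormG B rho P Q (u k - ubar) + sqnorm Q (delta u k).1.2)).
- by move=> k; apply: sqnormG_ge0.
- by move=> k; rewrite addr_ge0 ?sqnormG_ge0 ?Q_psd.
- by move=> k; apply: (sqnormG_delta_le admm).
- by move=> k; apply: (lyapunov_decrease admm).
Qed.
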